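(* Let $N=\{p_0,p_1,\dots,p_k\}$ be a set of $k+1$ distinct points ($k\geq 1$) in a Minkowski space $\mathbb{M}^n$. Then the star joining $p_0$ to each $p_i$, $i\in[k]$, is an SMT of $N$ if and only if $\langle\Sigma\rangle\neq\emptyset$ for each parenthesization $\langle\Sigma\rangle$ (with respect to the reduced Minkowski sum $\boxplus$) of the family $\Sigma=\{\partial(p_i-p_0): i\in[k]\}$.
   Context: $[k]=\{1,\dots,k\}$. A Minkowski space $\mathbb{M}^n$ is an $n$-dimensional real normed space $(\mathbb{R}^n,\|\cdot\|)$. A Steiner tree of a finite set $N\subset\mathbb{M}^n$ is a finite tree $T$ whose vertex set $V(T)$ is a finite set of points of $\mathbb{M}^n$ with $N\subseteq V(T)$; its length is $\ell(T)=\sum_{xy\in E(T)}\|x-y\|$. A Steiner minimal tree (SMT) of $N$ is a Steiner tree of $N$ of minimum length. The star joining $p_0$ to the points $p_1,\dots,p_k$ is the tree with edges $p_0p_i$, $i\in[k]$. The dual space $(\mathbb{M}^n)^*$ is the space of linear functionals with norm $\|\varphi\|^*=\max\{\varphi(x):\|x\|=1\}$, and $B^*$ is its closed unit ball. For non-zero $x\in\mathbb{M}^n$, $\partial x=\{\varphi:\|\varphi\|^*=1,\ \varphi(x)=\|x\|\}$ is the set of norming functionals of $x$. Reduced Minkowski sum: for closed convex subsets $C,D\subseteq B^*$, $C\boxplus D=\{\varphi+\psi:\varphi\in C,\psi\in D,\ \|\varphi+\psi\|^*\leq 1\}=(C+D)\cap B^*$ (so $C\boxplus D=\emptyset$ if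 $C$ or $D$ is empty). This operation is commutative but not associative. Parenthesizations: for a finite non-empty indexed family $\Sigma=\{A_i:i\in I\}$ of closed convex subsets of $B^*$, the parenthesizations $\langle\Sigma\rangle$ of $\Sigma$ are defined recursively: if $\Sigma=\{A_i\}$ is a singleton family, the only parenthesization is $\langle\Sigma\rangle=A_i$; if $\Sigma$ is the disjoint union of non-empty subfamilies $\Sigma_1,\Sigma_2$ with parenthesizations $\langle\Sigma_1\rangle,\langle\Sigma_2\rangle$, then $(\langle\Sigma_1\rangle\boxplus\langle\Sigma_2\rangle)$ is a parenthesization of $\Sigma$. Every parenthesization arises in this way (each member of the indexed family is used exactly once, in any order, with any bracketing), and is identified with the set it evaluates to. *)

(* Defs.v *)
From HB Require Import structures.
From mathcomp Require Import all_boot all_order all_algebra.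
From mathcomp Require Import finmap.
From mathcomp Require Import all_classical all_reals.

Set Implicit Arguments.
Unset Strict Implicit.
Unset Printing Implicit Defensive.

Import Order.TTheory GRing.Theory Num.Theory.

Local Open Scope classical_set_scope.
Local Open Scope ring_scope.

(* The Minkowski space is (R^n, N) with N : 'rV[R]_n -> R an arbitrary norm, so
   N is an explicit function: the canonical norm `|x| on 'rV[R]_n is the sup
   norm. *)
Record is_norm (R : realType) (n : nat) (N : 'rV[R]_n -> R) : Prop := IsNorm {
  norm_eq0_imp : forall x, N x = 0 -> x = 0 ;
  norm_triangle : forall x y, N (x + y) <= N x + N y ;
  norm_scale : forall (a : R) x, N (a *: x) = `|a| * N x }.

Definition dual (R : realType) (n : nat) := 'Hom('rV[R]_n, R^o).

(* As N is a norm on a finite-dimensional space, the supremum is finite, and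
   for 0 < n it is a maximum. *)
Definition dual_norm (R : realType) (n : nat) (N : 'rV[R]_n -> R)
    (phi : dual R n) : R :=
  sup [set phi x | x in [set x | N x = 1]].

Definition dual_ball (R : realType) (n : nat) (N : 'rV[R]_n -> R) :
    set (dual R n) :=
  [set phi | dual_norm N phi <= 1].

(* Only meant for x <> 0. *)
Definition norming (R : realType) (n : nat) (N : 'rV[R]_n -> R)
    (x : 'rV[R]_n) : set (dual R n) :=
  [set phi | dual_norm N phi = 1 /\ phi x = N x].

Definition rsum (R : realType) (n : nat) (N : 'rV[R]_n -> R)
    (C D : set (dual R n)) : set (dual R n) :=
  [set phi + psi | phi in C & psi in D] `&` dual_ball N.

(* [parenthesization N A J S]: S is the value of some parenthesization of the
   subfamily {A i : i in J}.  Subfamilies are sets of indices, so that equal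
   members with distinct indices are kept apart; J is never empty. *)
Inductive parenthesization (R : realType) (n : nat) (N : 'rV[R]_n -> R)
    (I : finType) (A : I -> set (dual R n)) :
    {set I} -> set (dual R n) -> Prop :=
| Paren_single (i : I) : parenthesization N A [set i]%SET (A i)
| Paren_sum (J1 J2 : {set I}) (S1 S2 : set (dual R n)) :
    (J1 :&: J2)%SET = finset.set0 ->
    parenthesization N A J1 S1 -> parenthesization N A J2 S2 ->
    parenthesization N A (J1 :|: J2)%SET (rsum N S1 S2).

Record point_graph (R : realType) (n : nat) := PointGraph {
  verts : {fset 'rV[R]_n} ;
  adj : rel 'rV[R]_n }.

Definition is_graph (R : realType) (n : nat) (T : point_graph R n) : Prop :=
  [/\ forall x y, adj T x y -> (x \in verts T) && (y \in verts T),
      symmetric (adj T) & irreflexive (adj T)].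

Definition connected_graph (R : realType) (n : nat) (T : point_graph R n) :
    Prop :=
  verts T != fset0 /\
  forall x y, x \in verts T -> y \in verts T ->
    exists2 s : seq 'rV[R]_n, path (adj T) x s & last x s = y.

(* [ucycle] also holds of [::] and of [:: x; y] for an edge xy; the cycles of a
   simple graph are the [ucycle]s of size at least 3. *)
Definition acyclic_graph (R : realType) (n : nat) (T : point_graph R n) :
    Prop :=
  forall c : seq 'rV[R]_n, ucycle (adj T) c -> (size c <= 2)%N.

Definition is_tree (R : realType) (n : nat) (T : point_graph R n) : Prop :=
  [/\ is_graph T, connected_graph T & acyclic_graph T].

(* The double sum meets each edge twice, as xy and as yx. *)
Definition graph_length (R : realType) (n : nat) (N : 'rV[R]_n -> R)
    (T : point_graph R n) : R :=
  (\sum_(x <- verts T) \sum_(y <- verts T | adj T x y) N (x - y)) / 2.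

Definition steiner_tree (R : realType) (n : nat) (P : {fset 'rV[R]_n})
    (T : point_graph R n) : Prop :=
  is_tree T /\ (P `<=` verts T)%fset.

Definition is_SMT (R : realType) (n : nat) (N : 'rV[R]_n -> R)
    (P : {fset 'rV[R]_n}) (T : point_graph R n) : Prop :=
  steiner_tree P T /\
  forall T' : point_graph R n, steiner_tree P T' ->
    graph_length N T <= graph_length N T'.

(* Only meant for c \notin L. *)
Definition star (R : realType) (n : nat) (c : 'rV[R]_n)
    (L : {fset 'rV[R]_n}) : point_graph R n :=
  PointGraph (c |` L)%fset
    (fun x y => (x == c) && (y \in L) || (y == c) && (x \in L)).

(* Main.v *)
(* Put p_0 at the origin. For one bracketing of [k], place the inner nodes of
   the corresponding rooted binary tree anywhere (coincidences allowed): the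
   total length is a convex function of these positions, and at the
   configuration collapsed onto p_0 it has subgradient 0 iff there is a flow of
   functionals in B^* along the edges, norming at the leaf edges and conserved
   at the inner nodes, i.e. iff the parenthesization is nonempty.

   If the star is minimal, every such configuration contains a Steiner tree
   that is no longer than it, so the collapsed one is a minimum; the flow is
   then extracted from the root downwards with the Hahn-Banach theorem, which
   splits a subgradient of a sum of two convex functions.

   Conversely, rooting any Steiner tree at p_0 and merging terminals while
   moving up to the root selects a bracketing, and a flow in it bounds the
   length of the star by that of the tree. *)

Require Import Defs.
From HB Require Import structures.
From mathcomp Require Import all_boot all_order all_algebra.
From mathcomp Require Import finmap.
From mathcomp Require Import all_classical all_reals.
From mathcomp Require Import topology normedtype derive.
From mathcomp Require Import ring lra.

Set Implicit Arguments.
Unset Strict Implicit.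
Unset Printing Implicit Defensive.

Import Order.TTheory GRing.Theory Num.Theory.
Import numFieldNormedType.Exports.

Local Open Scope classical_set_scope.
Local Open Scope ring_scope.

(** * Norms on R^n: comparison with the sup norm, dual ball and norming functionals *)

Lemma is_norm0 (R : realType) (n : nat) (N : 'rV[R]_n -> R) :
  is_norm N -> N 0 = 0.
Proof. by move=> hN; rewrite -(scale0r 0) (norm_scale hN) normr0 mul0r. Qed.

Lemma is_normN (R : realType) (n : nat) (N : 'rV[R]_n -> R) x :
  is_norm N -> N (- x) = N x.
Proof.
by move=> hN; rewrite -scaleN1r (norm_scale hN) normrN normr1 mul1r.
Qed.

Lemma is_normB (R : realType) (n : nat) (N : 'rV[R]_n -> R) x y :
  is_norm N -> N (x - y) = N (y - x).
Proof. by move=> hN; rewrite -opprB is_normN. Qed.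

Lemma is_norm_ge0 (R : realType) (n : nat) (N : 'rV[R]_n -> R) x :
  is_norm N -> 0 <= N x.
Proof.
move=> hN; have := norm_triangle hN x (- x).
by rewrite subrr is_norm0 // is_normN //; lra.
Qed.

Lemma is_norm_gt0 (R : realType) (n : nat) (N : 'rV[R]_n -> R) x :
  is_norm N -> x != 0 -> 0 < N x.
Proof.
move=> hN x0; rewrite lt_def is_norm_ge0 // andbT.
by apply: contra_neq x0; exact: norm_eq0_imp.
Qed.

Lemma coord_le_norm (R : realType) (n : nat) (x : 'rV[R]_n) (i : 'I_n) :
  `|x ord0 i| <= `|x|.
Proof.
rewrite [leRHS]/Num.norm /= mx_normrE; apply/bigmax_geP; right => /=.
by exists (ord0, i).
Qed.

Lemma is_norm_le_norm (R : realType) (n : nat) (N : 'rV[R]_n -> R) :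
  is_norm N -> exists C, forall x, N x <= C * `|x|.
Proof.
move=> hN; exists (\sum_i N (delta_mx 0 i)) => x.
rewrite {1}(row_sum_delta x) mulr_suml.
apply: (@le_trans _ _ (\sum_i N (x 0 i *: delta_mx 0 i))).
  elim/big_rec2: _ => [|i a b _ ab]; first by rewrite is_norm0.
  by apply: le_trans (norm_triangle hN _ _) _; rewrite lerD2l.
apply: ler_sum => i _; rewrite (norm_scale hN) mulrC.
by rewrite ler_wpM2l ?coord_le_norm // is_norm_ge0.
Qed.

(** [N] is Lipschitz for the sup norm, so it attains a minimum on the compact sup-norm unit sphere.
    This minimum is positive, and homogeneity carries the bound to all vectors. *)
Lemma norm_le_is_norm (R : realType) (n : nat) (N : 'rV[R]_n -> R) :
  is_norm N -> exists2 c, 0 < c & forall x, c * `|x| <= N x.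
Proof.
move=> hN; have [C NC] := is_norm_le_norm hN.
have [[x0 x0n0]|noex] := pselect (exists x : 'rV[R]_n, x != 0); last first.
  exists 1 => // x; suff -> : x = 0 by rewrite normr0 mulr0 is_norm0.
  by apply/eqP/negPn/negP => x0; apply: noex; exists x.
pose A : set 'rV[R]_n := [set x | `|x| = 1].
have A0 : A !=set0.
  exists (`|x0|^-1 *: x0).
  by rewrite /A /= normrZ normfV normr_id mulVf // normr_eq0.
(* [C] is only known to be real; its absolute value plus 1 is a positive Lipschitz constant. *)
have C1 : 0 < `|C| + 1 by rewrite ltr_wpDl.
have Nnear (x : 'rV[R]_n) e : 0 < e -> \forall y \near x, `|N x - N y| <= e.
  move=> e0; apply/nbhs_normP; exists (e / (`|C| + 1)).
    by rewrite /= divr_gt0.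
  move=> y /= /ltW xy; apply: (@le_trans _ _ (N (x - y))).
    have := norm_triangle hN (x - y) y; have := norm_triangle hN (y - x) x.
    by rewrite !subrK (is_normB y x hN) ler_norml => *; apply/andP; split; lra.
  apply: le_trans (NC _) _; apply: (@le_trans _ _ ((`|C| + 1) * `|x - y|)).
    by rewrite ler_wpM2r // (le_trans (ler_norm C)) // lerDl.
  by rewrite mulrC -ler_pdivlMr.
have Ncont : continuous N.
  by move=> x; apply/(@cvgrPdist_le _ _ _ (nbhs x)) => e e0; exact: Nnear.
have cA : compact A.
  apply: bounded_closed_compact.
    by exists 1; split => // M M1 x /= ->; exact: ltW.
  have /continuous_closedP : continuous (Num.norm : 'rV[R]_n -> R).
    exact: norm_continuous.
  by move=> /(_ [set 1] (@closed_eq _ 1)).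
have [c /set_mem cA1 cmin] := EVT_min_rV A0 cA (continuous_subspaceT Ncont).
exists (N c) => [|x].
  by rewrite is_norm_gt0 // -normr_eq0 cA1 oner_eq0.
have [->|xn0] := eqVneq x 0; first by rewrite normr0 mulr0 is_norm0.
have nx : 0 < `|x| by rewrite normr_gt0.
have /cmin : `|x|^-1 *: x \in A.
  by apply/mem_set; rewrite /A /= normrZ normfV normr_id mulVf // gt_eqF.
by rewrite (norm_scale hN) normfV normr_id mulrC ler_pdivlMr.
Qed.

Lemma dualZ (R : realType) (n : nat) (phi : dual R n) (a : R) x :
  (phi (a *: x) : R) = a * phi x.
Proof. exact: linearZ. Qed.

Lemma dual_le_norm (R : realType) (n : nat) (phi : dual R n) :
  exists C, forall x, (phi x : R) <= C * `|x|.
Proof.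
exists (\sum_i `|phi (delta_mx 0 i) : R|) => x.
rewrite {1}(row_sum_delta x) linear_sum mulr_suml /=; apply: ler_sum => i _.
rewrite dualZ (le_trans (ler_norm _)) // normrM.
by rewrite [leRHS]mulrC ler_wpM2r // coord_le_norm.
Qed.

(** Homogeneity passes between the unit sphere and all vectors. The supremum bounds the values only
    once they are known to be bounded, which comes from the comparison with the sup norm. *)
Lemma dual_ballP (R : realType) (n : nat) (N : 'rV[R]_n -> R)
    (phi : dual R n) :
  is_norm N -> dual_ball N phi <-> forall x, (phi x : R) <= N x.
Proof.
move=> hN; rewrite /dual_ball /dual_norm /=; set A := (X in sup X); split.
  move=> sA x; have [->|xn0] := eqVneq x 0; first by rewrite linear0 is_norm0.
  have Nx : 0 < N x by rewrite is_norm_gt0.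
  have supA : has_sup A.
    split.
      exists (phi ((N x)^-1 *: x) : R), ((N x)^-1 *: x) => //=.
      by rewrite (norm_scale hN) normfV gtr0_norm // mulVf // gt_eqF.
    have [C phiC] := dual_le_norm phi.
    have [c c0 Nc] := norm_le_is_norm hN.
    exists (`|C| / c) => _ [y /= Ny <-]; apply: le_trans (phiC y) _.
    rewrite ler_pdivlMr // -mulrA (le_trans (ler_norm _)) // normrM.
    rewrite -[leRHS]mulr1 ler_wpM2l // normrM normr_id gtr0_norm //.
    by rewrite mulrC -Ny.
  have : (phi ((N x)^-1 *: x) : R) <= 1.
    apply: le_trans sA; apply: sup_upper_bound => //.
    exists ((N x)^-1 *: x) => //=.
    by rewrite (norm_scale hN) normfV gtr0_norm // mulVf // gt_eqF.
  by rewrite dualZ mulrC ler_pdivrMr // mul1r.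
(* For n = 0 the unit sphere is empty and [sup] has its default value 0. *)
move=> phiN; have [->|/set0P A0] := eqVneq A set0; first by rewrite sup0.
by apply: ge_sup => // _ [x /= Nx <-]; rewrite -Nx.
Qed.

(** The pointwise bound keeps the dual norm at most 1, and the normalized [x] attains the value
    1. *)
Lemma normingP (R : realType) (n : nat) (N : 'rV[R]_n -> R) x
    (phi : dual R n) : is_norm N -> x != 0 ->
  norming N x phi <-> (forall y, (phi y : R) <= N y) /\ (phi x : R) = N x.
Proof.
move=> hN xn0; have Nx : 0 < N x by rewrite is_norm_gt0.
split=> [[phi1 phix]|[phiN phix]].
  by split => //; apply/(dual_ballP _ hN); rewrite /dual_ball /= phi1.
split => //; apply/eqP; rewrite eq_le; apply/andP; split.
  exact/(dual_ballP phi hN).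
apply: sup_upper_bound.
  split; first exists (phi ((N x)^-1 *: x) : R), ((N x)^-1 *: x) => //=.
    by rewrite (norm_scale hN) normfV gtr0_norm // mulVf // gt_eqF.
  by exists 1 => _ [y /= Ny <-]; rewrite -Ny.
exists ((N x)^-1 *: x); rewrite /=.
  by rewrite (norm_scale hN) normfV gtr0_norm // mulVf // gt_eqF.
by rewrite dualZ phix mulVf // gt_eqF.
Qed.

(** * Hahn-Banach: linear minorants of convex functions *)

Definition row_coord (R : realType) (n : nat) (i : 'I_n) (x : 'rV[R]_n) :
  R^o := x 0 i.

Fact row_coord_is_linear (R : realType) (n : nat) (i : 'I_n) :
  linear (@row_coord R n i).
Proof. by move=> a x y; rewrite /row_coord !mxE. Qed.

HB.instance Definition _ (R : realType) (n : nat) (i : 'I_n) :=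
  GRing.isLinear.Build R 'rV[R]_n R^o _ (row_coord i)
    (@row_coord_is_linear R n i).

(* [E x L] stands for [f x <= L] with [f] convex; working with relations avoids
   the infima in infimal convolutions. *)
Definition convex_rel (R : realType) (n : nat) (E : 'rV[R]_n -> R -> Prop) :=
  forall x y L M t, 0 <= t <= 1 -> E x L -> E y M ->
    E (t *: x + (1 - t) *: y) (t * L + (1 - t) * M).

(** One-dimensional extension step: by convexity, every slope forced from the side [- e] is at most
    every slope allowed on the side [+ e], so the supremum of the former is a value for [e]. *)
Lemma extend_minorant (R : realType) (n : nat) (E : 'rV[R]_n -> R -> Prop)
    (phi : dual R n) (W : 'rV[R]_n -> Prop) (e : 'rV[R]_n) :
  convex_rel E -> (forall x, exists L, E x L) -> W 0 ->
  (forall x y t, W x -> W y -> W (t *: x + (1 - t) *: y)) ->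
  (forall x L, W x -> E x L -> (phi x : R) <= L) ->
  exists c, forall x t L, W x -> E (x + t *: e) L -> phi x + t * c <= L.
Proof.
move=> Econv Etot W0 Wconv phiE.
pose B := [set b : R | exists x t L,
  [/\ W x, 0 < t, E (x - t *: e) L & b = (phi x - L) / t]].
have cross x t L x' t' L' : W x -> 0 < t -> E (x - t *: e) L ->
    W x' -> 0 < t' -> E (x' + t' *: e) L' ->
    (phi x - L) / t <= (L' - phi x') / t'.
  (* With this weight the multiples of [e] cancel, so the convex combination lies in [W], where
     [phi] is already a minorant. *)
  move=> Wx t0 EL Wx' t'0 EL'; pose s := t' / (t + t').
  have tt0 : 0 < t + t' by rewrite addr_gt0.
  have s1 : 1 - s = t / (t + t') by rewrite /s; field; rewrite gt_eqF.
  have s01 : 0 <= s <= 1.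
    by rewrite divr_ge0 ?(ltW t'0) ?(ltW tt0) //= ler_pdivrMr //; lra.
  have := Econv _ _ _ _ _ s01 EL EL'.
  have -> : s *: (x - t *: e) + (1 - s) *: (x' + t' *: e) =
            s *: x + (1 - s) *: x'.
    apply/rowP => j; rewrite !mxE s1 /s; field; rewrite gt_eqF //.
  move/(phiE _ _ (Wconv _ _ s Wx Wx')).
  rewrite linearD /= !dualZ s1 /s => h.
  rewrite ler_pdivrMr // mulrAC ler_pdivlMr //.
  suff : (phi x : R) * t' + phi x' * t <= t' * L + t * L' by lra.
  rewrite -(ler_pM2r (_ : 0 < (t + t')^-1)) ?invr_gt0 //; move: h.
  by congr (_ <= _); field; rewrite gt_eqF.
have B0 : B !=set0.
  have [L EL] := Etot (0 - 1 *: e).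
  by exists ((phi 0 - L) / 1), 0, 1, L.
have [L1 EL1] := Etot (0 + 1 *: e).
have supB : has_sup B.
  split=> //; exists ((L1 - phi 0) / 1) => _ [x [t [L [Wx t0 EL ->]]]].
  exact: cross.
exists (sup B) => x t L Wx EL; have [t0|t0|t0] := ltgtP t 0.
- have : (phi x - L) / (- t) <= sup B.
    apply: sup_upper_bound => //; exists x, (- t), L; split=> //.
      by rewrite oppr_gt0.
    by rewrite scaleNr opprK.
  by rewrite ler_pdivrMr ?oppr_gt0 //; lra.
- have : sup B <= (L - phi x) / t.
    by apply: ge_sup => // _ [x' [t' [L' [? ? ? ->]]]]; exact: cross.
  by rewrite ler_pdivlMr //; lra.
- by rewrite t0 mul0r addr0; apply: phiE; rewrite // -[x]addr0 -(scale0r e) -t0.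
Qed.

(** The zero functional is a minorant on the zero subspace; it is extended one coordinate at a time,
    through the subspaces [W m] of vectors supported on the first [m] coordinates. *)
Lemma convex_rel_minorant (R : realType) (n : nat)
    (E : 'rV[R]_n -> R -> Prop) :
  convex_rel E -> (forall x, exists L, E x L) ->
  (forall L, E 0 L -> 0 <= L) ->
  exists phi : dual R n, forall x L, E x L -> (phi x : R) <= L.
Proof.
move=> Econv Etot E0.
pose W m (x : 'rV[R]_n) := forall i : 'I_n, (m <= i)%N -> x 0 i = 0.
suff /(_ n)[phi phiE] m : exists phi : dual R n,
    forall x L, W m x -> E x L -> (phi x : R) <= L.
  by exists phi => x L; apply: phiE => i; rewrite leqNgt ltn_ord.
elim: m => [|m [phi phiE]].
  exists 0 => x L Wx; rewrite lfunE /= (_ : x = 0); first exact: E0.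
  by apply/rowP => i; rewrite Wx // mxE.
have [nm|mn] := leqP n m.
  exists phi => x L Wx; apply: phiE => i mi.
  by have := leq_trans (ltn_ord i) (leq_trans nm mi); rewrite ltnn.
pose i := Ordinal mn; pose e : 'rV[R]_n := delta_mx 0 i.
have [|x y t Wx Wy|c cE] := extend_minorant (W := W m) e Econv Etot _ _ phiE.
- by move=> j _; rewrite mxE.
- by move=> j mj; rewrite !mxE Wx // Wy // !mulr0 addr0.
(* The correction vanishes on [W m] and sets the value at [e] to [c]. *)
exists (phi + (c - phi e) *: linfun (row_coord i)) => x L Wx ExL.
rewrite !lfunE /= lfunE /= [_ *: _]/(_ * _) lfunE /= /row_coord.
have -> : (phi x : R) + (c - phi e) * x 0 i =
          phi (x - x 0 i *: e) + x 0 i * c.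
  by rewrite linearB /= dualZ; ring.
apply: cE; last by rewrite subrK.
move=> j mj; rewrite !mxE eqxx /=.
have [->|ji] := eqVneq j i; first by rewrite mulr1 subrr.
rewrite mulr0 subr0 Wx // ltn_neqAle mj andbT.
by apply: contra ji => /eqP ij; apply/eqP/val_inj.
Qed.

(** * Exhausting a connected graph from a root *)

(** For symmetric [e], twice the length of the subgraph induced on [A]; [A] is a parameter so that
    it can grow by one vertex at a time. *)
Definition edge_sum (R : realType) (n : nat) (N : 'rV[R]_n -> R)
    (e : rel 'rV[R]_n) (A : {fset 'rV[R]_n}) : R :=
  \sum_(x <- A) \sum_(y <- A | e x y) N (x - y).

Lemma edge_sumU1 (R : realType) (n : nat) (N : 'rV[R]_n -> R)
    (e : rel 'rV[R]_n) (A : {fset 'rV[R]_n}) u :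
  is_norm N -> symmetric e -> irreflexive e -> u \notin A ->
  edge_sum N e (u |` A)%fset =
  edge_sum N e A + 2 * \sum_(x <- A | e u x) N (u - x).
Proof.
move=> hN esym eirr uA; rewrite /edge_sum big_fsetU1 //= big_mkcond.
rewrite big_fsetU1 //= eirr add0r -big_mkcond /=.
under [X in _ + X]eq_bigr do rewrite big_mkcond big_fsetU1 //= -big_mkcond.
rewrite big_split /= -big_mkcond /=.
have -> : \sum_(x <- A | e x u) N (x - u) = \sum_(x <- A | e u x) N (u - x).
  by apply: eq_big => x; [rewrite esym | rewrite is_normB].
by ring.
Qed.

(** A rooted tree recorded only by the order of attachment and the total length: undoing the
    constructors removes one leaf at a time, which is the induction needed for gathering
    terminals. *)
Inductive branching (R : realType) (n : nat) (N : 'rV[R]_n -> R)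
    (r : 'rV[R]_n) : {fset 'rV[R]_n} -> R -> Prop :=
| Branching_root : branching N r [fset r]%fset 0
| Branching_grow A l x y : branching N r A l -> x \in A -> y \notin A ->
    branching N r (y |` A)%fset (l + N (y - x)).

Lemma path_exit (T : eqType) (e : rel T) (P : pred T) x s :
  path e x s -> P x -> ~~ P (last x s) ->
  exists a b, [/\ P a, ~~ P b & e a b].
Proof.
elim: s x => [|y s IHs] x /=; first by move=> _ ->.
case/andP=> exy pys Px; have [Py|nPy] := boolP (P y); first exact: IHs.
by exists x, y.
Qed.

(** As long as a vertex is missing from [A], a path to it leaves [A] through some edge, and the
    outer end of that edge is attached. The length stays below that of the subgraph induced on [A];
    [m] bounds the number of missing vertices. *)
Lemma connected_branching (R : realType) (n : nat) (N : 'rV[R]_n -> R)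
    (T : point_graph R n) r :
  is_norm N -> is_graph T -> connected_graph T -> r \in verts T ->
  exists2 l, branching N r (verts T) l & l <= graph_length N T.
Proof.
move=> hN [adjV adjC adj_irr] [_ conT] rT.
suff grow m A l : branching N r A l -> (A `<=` verts T)%fset ->
    2 * l <= edge_sum N (adj T) A -> (#|` verts T| <= m + #|` A|)%N ->
    exists2 l, branching N r (verts T) l & l <= graph_length N T.
  apply: (grow #|` verts T| _ _ (Branching_root N r)).
  - by rewrite fsub1set.
  - rewrite mulr0 sumr_ge0 // => x _.
    by rewrite sumr_ge0 // => y _; exact: is_norm_ge0.
  - exact: leq_addr.
elim: m A l => [|m IHm] A l brA AT lA cA.
  have AE : A = verts T by apply/eqP; rewrite eqEfcard AT.
  rewrite AE in brA lA; exists l => //.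
  by rewrite ler_pdivlMr // mulrC.
have [AE|AnT] := eqVneq A (verts T).
  rewrite AE in brA lA; exists l => //.
  by rewrite ler_pdivlMr // mulrC.
have [z zT zA] : exists2 z, z \in verts T & z \notin A.
  have /fsubsetPn[z zT zA] : ~~ (verts T `<=` A)%fset.
    by apply: contra AnT => TA; rewrite eqEfsubset AT.
  by exists z.
have rA : r \in A.
  elim: brA => [|A' l' x y _ rA' _ _]; first exact: fset11.
  by rewrite inE rA' orbT.
have [s ps sz] := conT _ _ rT zT.
have [||a [b [aA bA ab]]] := path_exit (P := [in A]) ps; rewrite ?sz //.
apply: (IHm _ _ (Branching_grow brA aA bA)).
- by rewrite fsubUset fsub1set AT andbT; case/andP: (adjV _ _ ab).
(* Of all edges from [b] into [A], only [ab] is kept in the estimate. *)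
- rewrite mulrDr edge_sumU1 // lerD // ler_wpM2l //.
  rewrite big_mkcond (big_fsetD1 a) //= adjC ab lerDl sumr_ge0 // => x _.
  by case: ifP => // _; exact: is_norm_ge0.
- by rewrite cardfsU1 bA addnCA addnA (leq_trans cA) // addnC addSnnS.
Qed.

(** * Gathering the terminals at the root: nonempty parenthesizations bound the star *)

(* [v] is a point of the tree to which the terminals [q i], [i \in J], have
   been moved along edges of total length [L]; at [v = r] the bound becomes the
   comparison of the star with the tree. *)
Definition gathered (R : realType) (n : nat) (N : 'rV[R]_n -> R)
    (I : finType) (q : I -> 'rV[R]_n) (r v : 'rV[R]_n) (J : {set I}) (L : R) :=
  J = finset.set0 /\ 0 <= L \/
  exists2 S, parenthesization N (fun i => norming N (q i - r)) J S &
    forall phi, S phi -> \sum_(i in J) N (q i - r) <= L + phi (v - r).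

Lemma sum_disjoint_setU (R : nmodType) (I : finType) (J1 J2 : {set I})
    (F : I -> R) :
  (J1 :&: J2)%SET = finset.set0 ->
  \sum_(i in (J1 :|: J2)%SET) F i = \sum_(i in J1) F i + \sum_(i in J2) F i.
Proof.
move=> J12; rewrite -bigU; first by apply: eq_bigl => i; rewrite !inE.
by rewrite -finset.setI_eq0 J12.
Qed.

(** A functional of the reduced sum is [phi + psi], so the two bounds at the common point [v] add
    up; an empty group contributes no factor to the bracketing. *)
Lemma gathered_join (R : realType) (n : nat) (N : 'rV[R]_n -> R)
    (I : finType) (q : I -> 'rV[R]_n) r v (J1 J2 : {set I}) L1 L2 :
  (J1 :&: J2)%SET = finset.set0 ->
  gathered N q r v J1 L1 -> gathered N q r v J2 L2 ->
  gathered N q r v (J1 :|: J2)%SET (L1 + L2).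
Proof.
move=> J12 [[-> L10]|[S1 par1 S1L]] [[-> L20]|[S2 par2 S2L]].
- by left; rewrite finset.setU0 addr_ge0.
- right; exists S2; rewrite finset.set0U // => phi /S2L; lra.
- right; exists S1; rewrite finset.setU0 // => phi /S1L; lra.
- right; exists (rsum N S1 S2); first exact: Paren_sum.
  move=> _ [[phi Sphi [psi Spsi <-]] _].
  rewrite (sum_disjoint_setU _ J12) /= lfunE /=.
  have := S1L _ Sphi; have := S2L _ Spsi; lra.
Qed.

Lemma paren_dual_ball (R : realType) (n : nat) (N : 'rV[R]_n -> R)
    (I : finType) (x : I -> 'rV[R]_n) J S :
  parenthesization N (fun i => norming N (x i)) J S -> S `<=` dual_ball N.
Proof.
case=> [i phi [phi1 _]|J1 J2 S1 S2 _ _ _ phi []] //.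
by rewrite /dual_ball /= phi1.
Qed.

(** This is where the restriction to the ball in the reduced sum enters: [phi (v - u)] is at most
    [N (v - u)]. *)
Lemma gathered_move (R : realType) (n : nat) (N : 'rV[R]_n -> R)
    (I : finType) (q : I -> 'rV[R]_n) r u v (J : {set I}) L :
  is_norm N -> gathered N q r v J L ->
  gathered N q r u J (L + N (v - u)).
Proof.
move=> hN [[-> L0]|[S parS SL]]; [left|right].
  by split=> //; rewrite addr_ge0 // is_norm_ge0.
exists S => // phi Sphi; apply: le_trans (SL _ Sphi) _.
rewrite -addrA lerD2l -(subrK u v) -[_ + u - r]addrA linearD lerD2r /=.
by rewrite addrK; move: (paren_dual_ball parS Sphi) => /(dual_ballP _ hN).
Qed.

(** [h] gives the current position of each terminal and [L v] the length already spent at [v]. The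
    last attached vertex [y] is a leaf: its terminals are moved to its parent [x] and joined with
    those there. *)
Lemma branching_gathered (R : realType) (n : nat) (N : 'rV[R]_n -> R)
    (I : finType) (q : I -> 'rV[R]_n) r A l (h : I -> 'rV[R]_n) L :
  is_norm N -> branching N r A l -> (forall i, h i \in A) ->
  (forall v, v \in A -> gathered N q r v [set i | h i == v]%SET (L v)) ->
  gathered N q r r [set: I]%SET (l + \sum_(v <- A) L v).
Proof.
move=> hN brA; elim: brA h L => [|{}A {}l x y brA IH xA yA] h L hA gathL.
  rewrite add0r big_seq_fset1.
  have <- : [set i | h i == r]%SET = [set: I]%SET.
    by apply/setP => i; rewrite !inE; have := hA i; rewrite inE.
  by apply: gathL; rewrite inE.
pose h' i := if h i == y then x else h i.
(* [x] takes over what was spent at [y] and pays for the edge. *)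
pose L' v := L v + (if v == x then L y + N (y - x) else 0).
have -> : l + N (y - x) + \sum_(v <- (y |` A)%fset) L v =
          l + \sum_(v <- A) L' v.
  rewrite big_fsetU1 //= /L' big_split /=.
  have -> : \sum_(v <- A) (if v == x then L y + N (y - x) else 0) =
            L y + N (y - x); last by ring.
  rewrite (big_fsetD1 x) //= eqxx big1_fset ?addr0 // => v.
  by rewrite !inE => /andP[/negPf->].
apply: (IH h' L') => [i|v vA]; rewrite /h' /L'.
  by case: eqP => // /eqP hi; have := hA i; rewrite !inE (negPf hi).
have yx : y != x by apply: contraNneq yA => ->.
have vy : v != y by apply: contraNneq yA => <-.
have gv : gathered N q r v [set i | h i == v]%SET (L v).
  by apply: gathL; rewrite inE vA orbT.
case: (eqVneq v x) => [vx|vx]; last first.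
  rewrite addr0; suff -> : [set i | (if h i == y then x else h i) == v]%SET =
    [set i | h i == v]%SET by [].
  apply/setP => i; rewrite !inE; case: (eqVneq (h i) y) => // ->.
  by rewrite eq_sym (negPf vx) eq_sym (negPf vy).
subst v; have -> : [set i | h' i == x]%SET =
    ([set i | h i == x] :|: [set i | h i == y])%SET.
  apply/setP => i; rewrite !inE /h'.
  by case: (eqVneq (h i) y) => [->|]; rewrite ?eqxx ?orbT ?orbF.
apply: gathered_join => //; last first.
  by apply: gathered_move => //; apply: gathL; rewrite !inE eqxx.
apply/setP => i; rewrite !inE.
by case: (eqVneq (h i) x) => // ->; rewrite eq_sym (negPf yx).
Qed.

(** Each terminal starts at its own position with nothing spent, since a norming functional gives
    equality there. At the root the functional is evaluated at 0, so any element of the resulting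
    parenthesization yields the bound. *)
Lemma star_le_connected (R : realType) (n : nat) (N : 'rV[R]_n -> R)
    (I : finType) (q : I -> 'rV[R]_n) r (T : point_graph R n) (i0 : I) :
  is_norm N -> injective q -> (forall i, q i != r) ->
  (forall S, parenthesization N (fun i => norming N (q i - r))
     [set: I]%SET S -> S !=set0) ->
  is_graph T -> connected_graph T -> r \in verts T ->
  (forall i, q i \in verts T) ->
  \sum_i N (q i - r) <= graph_length N T.
Proof.
move=> hN q_inj qr parS gT cT rT qT.
have [l brT lT] := connected_branching hN gT cT rT; apply: le_trans lT.
have [v vT||] := branching_gathered (q := q) (h := q) (L := fun=> 0) hN brT qT.
- have [[i qi]|noi] := pselect (exists i, q i = v); last first.
    left; split=> //; apply/setP => i; rewrite !inE.
    by apply/eqP => qi; apply: noi; exists i.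
  have -> : [set j | q j == v]%SET = [set i]%SET.
    by apply/setP => j; rewrite !inE -qi (inj_eq q_inj).
  right; exists (norming N (q i - r)); first exact: Paren_single.
  move=> phi [_ phiE]; rewrite big_set1 add0r -qi.
  by rewrite phiE.
(* The index [i0] excludes the empty group. *)
- by case=> /setP/(_ i0); rewrite !inE.
- move=> [S /[dup] /parS[phi Sphi] _ /(_ _ Sphi)].
  rewrite subrr linear0 [X in _ <= _ + X + _]big1 // !addr0.
  by under eq_bigl do rewrite inE.
Qed.

(** * Building trees: leaves, single points and stars *)

Definition add_leaf (R : realType) (n : nat) (T : point_graph R n)
    (v u : 'rV[R]_n) : point_graph R n :=
  PointGraph (u |` verts T)%fset
    (fun x y => adj T x y || (x == u) && (y == v) || (x == v) && (y == u)).

Lemma add_leaf_tree (R : realType) (n : nat) (T : point_graph R n) v u :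
  is_tree T -> v \in verts T -> u \notin verts T -> is_tree (add_leaf T v u).
Proof.
move=> [[adjV adjC adj_irr] [VT conT] acyT] vT uT.
have vu : v != u by apply: contraNneq uT => <-.
have adjuF x : adj T u x = false.
  by apply/negP => /adjV/andP[]; rewrite (negPf uT).
have adjFu x : adj T x u = false by rewrite adjC.
split; first split => /=.
- move=> x y /orP[/orP[/adjV/andP[xT yT]|/andP[/eqP-> /eqP->]]|
    /andP[/eqP-> /eqP->]]; by rewrite !inE ?xT ?yT ?vT ?eqxx ?orbT.
- move=> x y; rewrite /= adjC -!orbA; congr (_ || _).
  by rewrite orbC andbC [(x == u) && _]andbC.
- move=> x; rewrite /= adj_irr /=.
  by case: eqVneq => [->|]; rewrite ?(eq_sym u) ?(negPf vu) ?andbF.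
- split; first by apply/fset0Pn; exists u; rewrite !inE eqxx.
  pose conn x y := exists2 s, path (adj (add_leaf T v u)) x s & last x s = y.
  have conn_trans y x z : conn x y -> conn y z -> conn x z.
    move=> [s ps <-] [s' ps' <-]; exists (s ++ s'); last by rewrite last_cat.
    by rewrite cat_path ps.
  have connT x y : x \in verts T -> y \in verts T -> conn x y.
    move=> xT yT; have [s ps sy] := conT x y xT yT; exists s => //.
    by apply: sub_path ps => a b /= ->.
  move=> x y; rewrite !inE => xT yT; apply: (conn_trans v).
    case/predU1P: xT => [->|xT]; last exact: connT.
    by exists [:: v]; rewrite //= !eqxx orbT.
  case/predU1P: yT => [->|yT]; last exact: connT.
  by exists [:: u]; rewrite //= !eqxx orbT.
- move=> c; rewrite leqNgt; apply: contraPN => c3 /andP[].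
  have [uc|uc] := boolP (u \in c); last first.
    rewrite (eq_in_cycle (P := [in c]) (e' := adj T)) //.
      move=> cc uqc; have := acyT c.
      by rewrite leqNgt c3 /ucycle cc => /(_ uqc).
    move=> x y xc yc /=; have /negPf-> : x != u by apply: contraNneq uc => <-.
    have /negPf-> : y != u by apply: contraNneq uc => <-.
    by rewrite andbF !orbF.
  (* Rotated to start at [u], the cycle has [v], the only neighbour of [u], both in second and in
     last place; these places differ, so [v] is repeated. *)
  case: (rot_to uc) => i s rots; move: c3.
  rewrite -(rot_cycle i) -(rot_uniq i) -(size_rot i) {}rots.
  case: s => [|y [|z s]] //= _; rewrite rcons_path /= adjuF adjFu !eqxx andbT.
  rewrite [u == v]eq_sym (negPf vu) andbF !orbF /=.
  move=> /andP[/eqP-> /andP[_ /andP[_ /eqP <-]]].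
  by rewrite mem_last andbF.
Qed.

Lemma graph_lengthE (R : realType) (n : nat) (N : 'rV[R]_n -> R)
    (T : point_graph R n) :
  graph_length N T = edge_sum N (adj T) (verts T) / 2.
Proof. by []. Qed.

Lemma add_leaf_length (R : realType) (n : nat) (N : 'rV[R]_n -> R)
    (T : point_graph R n) v u :
  is_norm N -> is_tree T -> v \in verts T -> u \notin verts T ->
  graph_length N (add_leaf T v u) = graph_length N T + N (u - v).
Proof.
move=> hN tT vT uT; have [[_ lC l_irr] _ _] := add_leaf_tree tT vT uT.
have [[adjV _ _] _ _] := tT.
rewrite !graph_lengthE edge_sumU1 //= mulrDl [2 * _]mulrC mulfK ?pnatr_eq0 //.
have neu x : x \in verts T -> (x == u) = false.
  by move=> xT; apply: contraNF uT => /eqP <-.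
congr (_ / _ + _).
  rewrite /edge_sum big_seq [RHS]big_seq; apply: eq_bigr => x xT.
  rewrite big_seq_cond [RHS]big_seq_cond; apply: eq_bigl => y.
  by have [yT|//] := boolP (y \in verts T); rewrite !neu //= andbF !orbF.
have uxE x : x \in verts T ->
    adj T u x || (u == u) && (x == v) || (u == v) && (x == u) = (x == v).
  move=> xT; rewrite eqxx neu // andbF orbF /=.
  suff -> : adj T u x = false by [].
  by apply/negP => /adjV/andP[]; rewrite (negPf uT).
rewrite big_seq_cond big_mkcond (big_fsetD1 v) //= vT uxE // eqxx.
rewrite big1_fset ?addr0 // => x; rewrite !inE => /andP[xv xT] _.
by rewrite xT uxE // (negPf xv).
Qed.

(** The inequality covers coincidences: if [u] is already a vertex, the tree is kept unchanged. *)
Lemma tree_extend (R : realType) (n : nat) (N : 'rV[R]_n -> R)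
    (T : point_graph R n) v u :
  is_norm N -> is_tree T -> v \in verts T ->
  exists T', [/\ is_tree T', (verts T `<=` verts T')%fset, u \in verts T' &
    graph_length N T' <= graph_length N T + N (u - v)].
Proof.
move=> hN tT vT; have [uT|uT] := boolP (u \in verts T).
  by exists T; rewrite lerDl is_norm_ge0.
exists (add_leaf T v u); split.
- exact: add_leaf_tree.
- exact: fsubsetU1.
- exact: fset1U1.
- by rewrite add_leaf_length.
Qed.

Definition point_tree (R : realType) (n : nat) (r : 'rV[R]_n) :
  point_graph R n := PointGraph [fset r]%fset (fun _ _ => false).

Lemma point_treeP (R : realType) (n : nat) (r : 'rV[R]_n) :
  is_tree (point_tree r).
Proof.
split; first by split.
  split; first by apply/fset0Pn; exists r; rewrite inE.
  by move=> x y; rewrite !inE => /eqP-> /eqP->; exists [::].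
by case=> [|x [|y s]].
Qed.

Lemma point_tree_length (R : realType) (n : nat) (N : 'rV[R]_n -> R) r :
  graph_length N (point_tree r) = 0.
Proof.
by rewrite graph_lengthE /edge_sum big1 ?mul0r // => x _; rewrite big_pred0.
Qed.

Lemma star_tree (R : realType) (n : nat) (c : 'rV[R]_n)
    (L : {fset 'rV[R]_n}) : c \notin L -> is_tree (star c L).
Proof.
move=> cL; split; first split=> /=.
- by move=> x y /orP[]/andP[/eqP-> H]; rewrite !inE eqxx H orbT.
- by move=> x y; rewrite /= orbC.
- by move=> x; rewrite /= orbb; case: eqP => // ->; rewrite (negPf cL).
- split; first by apply/fset0Pn; exists c; rewrite !inE eqxx.
  move=> x y; rewrite !inE.
  case: (eqVneq x c) => [->|xc] /= xL; case: (eqVneq y c) => [->|yc] /= yL.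
  + by exists [::].
  + by exists [:: y]; rewrite //= eqxx yL.
  + by exists [:: c]; rewrite //= eqxx xL orbT.
  + by exists [:: c; y]; rewrite //= !eqxx xL yL orbT.
- have adjE x y : x != c -> y != c -> adj (star c L) x y = false.
    by move=> /negPf xc /negPf yc; rewrite /= xc yc.
  have {}adjE : forall x y, adj (star c L) x y -> (x == c) || (y == c).
    move=> x y exy; apply: contraT; rewrite negb_or => /andP[xc yc].
    by rewrite adjE in exy.
  rewrite /acyclic_graph; move: (adj _) adjE => e adjE.
  move=> [|x [|y [|z s]]] // /andP[/= /and3P[exy eyz pz]].
  rewrite !inE !negb_or => /andP[/and3P[xy xz xs] /andP[/andP[yz ys] _]].
  (* Every edge contains [c]; if [y] were not [c], both its neighbours [x] and [z] would be. *)
  have yc : y = c.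
    apply/eqP; apply: contraT => yc.
    have /orP[/eqP xc|] := adjE _ _ exy; last by rewrite (negPf yc).
    have /orP[|/eqP zc] := adjE _ _ eyz; first by rewrite (negPf yc).
    by rewrite xc zc eqxx in xz.
  (* The edge leaving [z] must contain [c] as well, but [c = y] occurs only once on the cycle. *)
  case: s pz xs ys => [|w s] /= /andP[/adjE + _].
    by rewrite -yc eq_sym (negPf yz) (negPf xy).
  by rewrite -yc eq_sym (negPf yz) /= => /eqP -> _; rewrite inE eqxx.
Qed.

Lemma star_length (R : realType) (n : nat) (N : 'rV[R]_n -> R)
    (c : 'rV[R]_n) (L : {fset 'rV[R]_n}) :
  is_norm N -> c \notin L ->
  graph_length N (star c L) = \sum_(x <- L) N (x - c).
Proof.
move=> hN cL; have [[_ sC s_irr] _ _] := star_tree cL.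
rewrite graph_lengthE edge_sumU1 //= mulrDl [2 * _]mulrC mulfK ?pnatr_eq0 //.
have nec x : x \in L -> (x == c) = false.
  by move=> xL; apply: contraNF cL => /eqP <-.
rewrite /edge_sum big_seq big1 => [|x xL]; last first.
  rewrite big_seq_cond big_pred0 // => y.
  by have [/nec->|//] := boolP (y \in L); rewrite nec.
rewrite mul0r add0r big_seq_cond [RHS]big_seq; apply: eq_big => x.
  by have [xL|//] := boolP (x \in L); rewrite eqxx.
by move=> _; exact: is_normB.
Qed.

(** * Convex cost of a bracketing and its subgradients at the star *)

Lemma is_norm_convex (R : realType) (n : nat) (N : 'rV[R]_n -> R) x y t :
  is_norm N -> 0 <= t <= 1 ->
  N (t *: x + (1 - t) *: y) <= t * N x + (1 - t) * N y.
Proof.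
move=> hN /andP[t0 t1]; apply: le_trans (norm_triangle hN _ _) _.
by rewrite !(norm_scale hN) !ger0_norm ?subr_ge0.
Qed.

(* The tree certifying [E x L] hangs below the point [r + x]; the last clause
   says that the subgradients of the optimal length at [x = 0] lie in [- S]. *)
Record cost_rel (R : realType) (n : nat) (N : 'rV[R]_n -> R) (I : finType)
    (q : I -> 'rV[R]_n) (r : 'rV[R]_n) (J : {set I}) (S : set (dual R n))
    (E : 'rV[R]_n -> R -> Prop) : Prop := CostRel {
  cost_convex : convex_rel E ;
  cost_total : forall x, exists L, E x L ;
  cost_star : E 0 (\sum_(i in J) N (q i - r)) ;
  cost_tree : forall x L T, E x L -> is_tree T -> r + x \in verts T ->
    exists T', [/\ is_tree T', (verts T `<=` verts T')%fset,
      forall i, i \in J -> q i \in verts T' &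
      graph_length N T' <= graph_length N T + L] ;
  cost_subgradient : forall phi : dual R n,
    (forall x L, E x L -> \sum_(i in J) N (q i - r) - phi x <= L) -> S phi }.

Lemma cost_rel_single (R : realType) (n : nat) (N : 'rV[R]_n -> R)
    (I : finType) (q : I -> 'rV[R]_n) r i :
  is_norm N -> q i != r ->
  cost_rel N q r [set i]%SET (norming N (q i - r))
    (fun x L => N (q i - r - x) <= L).
Proof.
move=> hN qir; split.
- move=> x y L M t t01 xL yM.
  have -> : q i - r - (t *: x + (1 - t) *: y) =
            t *: (q i - r - x) + (1 - t) *: (q i - r - y).
    by apply/rowP => j; rewrite !mxE; ring.
  apply: le_trans (is_norm_convex _ _ hN t01) _; case/andP: t01 => t0 t1.
  by rewrite lerD // ler_wpM2l // subr_ge0.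
- by move=> x; exists (N (q i - r - x)).
- by rewrite big_set1 subr0.
- move=> x L T xL tT xT.
  have [T' [tT' TT' iT' lT']] := tree_extend (q i) hN tT xT.
  exists T'; split=> // [j|]; first by rewrite inE => /eqP ->.
  by apply: le_trans lT' _; rewrite lerD2l opprD addrA.
- move=> phi; rewrite big_set1 => phiE; apply/normingP; rewrite ?subr_eq0 //.
  (* The subgradient inequality at [- y] gives the bound by [N], and at [q i - r] the norming
     equality. *)
  have phiN y : (phi y : R) <= N y.
    have := phiE (- y) _ (lexx _); rewrite linearN /= !opprK.
    by have := norm_triangle hN (q i - r) y; lra.
  split=> //; apply/eqP; rewrite eq_le phiN.
  by have := phiE (q i - r) _ (lexx _); rewrite subrr is_norm0 // subr_le0.
Qed.

(** The new cost is the infimal convolution of [N] with the sum of the two costs: the inner node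
    sits at [s], joined to [x] above it, with both subtrees hanging below. Its subgradients lie in
    the ball because of [N], and split because of the sum rule. *)
Lemma cost_rel_sum (R : realType) (n : nat) (N : 'rV[R]_n -> R)
    (I : finType) (q : I -> 'rV[R]_n) r (J1 J2 : {set I}) S1 S2 E1 E2 :
  is_norm N -> (J1 :&: J2)%SET = finset.set0 ->
  cost_rel N q r J1 S1 E1 -> cost_rel N q r J2 S2 E2 ->
  cost_rel N q r (J1 :|: J2)%SET (rsum N S1 S2)
    (fun x L => exists s L1 L2,
       [/\ E1 s L1, E2 s L2 & N (s - x) + L1 + L2 <= L]).
Proof.
move=> hN J12 [conv1 tot1 star1 tree1 sub1] [conv2 tot2 star2 tree2 sub2].
split.
- move=> x y L M t t01 [s [L1 [L2 [s1 s2 sL]]]] [s' [M1 [M2 [s1' s2' sM]]]].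
  exists (t *: s + (1 - t) *: s'), (t * L1 + (1 - t) * M1),
    (t * L2 + (1 - t) * M2); split; [exact: conv1|exact: conv2|].
  have -> : t *: s + (1 - t) *: s' - (t *: x + (1 - t) *: y) =
            t *: (s - x) + (1 - t) *: (s' - y).
    by apply/rowP => j; rewrite !mxE; ring.
  have h := is_norm_convex (s - x) (s' - y) hN t01; case/andP: t01 => t0 t1.
  have : t * (N (s - x) + L1 + L2) <= t * L by rewrite ler_wpM2l.
  have : (1 - t) * (N (s' - y) + M1 + M2) <= (1 - t) * M.
    by rewrite ler_wpM2l ?subr_ge0.
  lra.
- move=> x; have [L1 xL1] := tot1 x; have [L2 xL2] := tot2 x.
  by exists (N (x - x) + L1 + L2), x, L1, L2.
- eexists 0, _, _; split; [exact: star1|exact: star2|].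
  by rewrite subr0 is_norm0 // add0r sum_disjoint_setU.
- move=> x L T [s [L1 [L2 [s1 s2 sL]]]] tT xT.
  (* The inner node is attached first, then the two subtrees are grown from it in turn. *)
  have [T0 [tT0 TT0 sT0 lT0]] := tree_extend (r + s) hN tT xT.
  have [T1 [tT1 T01 J1T1 lT1]] := tree1 _ _ _ s1 tT0 sT0.
  have [T2 [tT2 T12 J2T2 lT2]] := tree2 _ _ _ s2 tT1 (fsubsetP T01 _ sT0).
  exists T2; split=> //.
  + exact: fsubset_trans TT0 (fsubset_trans T01 T12).
  + by move=> i; rewrite inE => /orP[/J1T1/(fsubsetP T12)|/J2T2].
  + have sx : s - x = r + s - (r + x) by rewrite opprD addrACA subrr add0r.
    rewrite sx in sL.
    lra.
move=> phi; rewrite sum_disjoint_setU //.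
set w1 := \sum_(i in J1) _ in star1 sub1 *.
set w2 := \sum_(i in J2) _ in star2 sub2 *.
move=> phiE.
(* A minorant of the infimal convolution of E1 and the reflected E2 + phi
   separates the two. *)
pose F z M := exists a b L1 L2, [/\ z = a - b, E1 a L1, E2 b L2 &
  M = L1 + L2 - w1 - w2 + phi b].
have [||L|psi psiF] := @convex_rel_minorant R n F.
- move=> ? ? ? ? t t01 [a [b [L1 [L2 [-> a1 b2 ->]]]]].
  move=> [a' [b' [M1 [M2 [-> a1' b2' ->]]]]].
  exists (t *: a + (1 - t) *: a'), (t *: b + (1 - t) *: b'),
    (t * L1 + (1 - t) * M1), (t * L2 + (1 - t) * M2).
  split; [|exact: conv1|exact: conv2|].
    by apply/rowP => j; rewrite !mxE; ring.
  by rewrite linearD /= !dualZ; ring.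
- move=> z; have [L1 zL1] := tot1 z.
  by eexists; exists z, 0, L1, w2; rewrite subr0.
- move=> [a [b [L1 [L2 [/esym/eqP]]]]]; rewrite subr_eq0 => /eqP <- a1 a2 ->.
  suff /phiE : exists s L1' L2',
      [/\ E1 s L1', E2 s L2' & N (s - a) + L1' + L2' <= L1 + L2].
    lra.
  by exists a, L1, L2; rewrite subrr is_norm0 // add0r.
split; last first.
  apply/(dual_ballP _ hN) => x.
  (* The inner node stays at 0 while the point above it moves to [- x]. *)
  have : exists s L1' L2',
      [/\ E1 s L1', E2 s L2' & N (s - (- x)) + L1' + L2' <= N x + w1 + w2].
    by exists 0, w1, w2; rewrite opprK add0r.
  by move=> /phiE; rewrite linearN /=; lra.
(* Setting [b = 0] in the minorant puts [- psi] in [S1]; setting [a = 0] puts [phi + psi] in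
   [S2]. *)
exists (- psi); last exists (phi + psi).
- apply: sub1 => x L xL; rewrite opp_lfunE.
  have /psiF : F x (L + w2 - w1 - w2 + phi 0).
    by exists x, 0, L, w2; rewrite subr0.
  by rewrite linear0; lra.
- apply: sub2 => x L xL; rewrite lfunE /=.
  have /psiF : F (- x) (w1 + L - w1 - w2 + phi x).
    by exists 0, x, w1, L; rewrite sub0r.
  by rewrite linearN /=; lra.
- by rewrite addrCA addNr addr0.
Qed.

Lemma paren_cost_rel (R : realType) (n : nat) (N : 'rV[R]_n -> R)
    (I : finType) (q : I -> 'rV[R]_n) r J S :
  is_norm N -> (forall i, q i != r) ->
  parenthesization N (fun i => norming N (q i - r)) J S ->
  exists E, cost_rel N q r J S E.
Proof.
move=> hN qr; elim=> [i|J1 J2 S1 S2 J12 _ [E1 c1] _ [E2 c2]].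
  by eexists; exact: cost_rel_single.
by eexists; exact: (cost_rel_sum hN J12 c1 c2).
Qed.

(** Minimality of the star makes the cost at 0 at least [w]. The cost lowered by [w] then has a
    linear minorant, whose opposite is the required functional. *)
Lemma paren_nonempty (R : realType) (n : nat) (N : 'rV[R]_n -> R)
    (I : finType) (q : I -> 'rV[R]_n) r S :
  is_norm N -> (forall i, q i != r) ->
  (forall T, is_tree T -> r \in verts T -> (forall i, q i \in verts T) ->
    \sum_i N (q i - r) <= graph_length N T) ->
  parenthesization N (fun i => norming N (q i - r)) [set: I]%SET S ->
  S !=set0.
Proof.
move=> hN qr min_star /(paren_cost_rel hN qr)[E [convE totE _ treeE subE]].
move: subE; set w := \sum_(i in _) _ => subE.
have wE : w = \sum_i N (q i - r) by apply: eq_bigl => i; rewrite inE.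
have [||L|psi psiE] := @convex_rel_minorant R n (fun x L => E x (L + w)).
- move=> x y L M t t01 xL yM; have := convE _ _ _ _ _ t01 xL yM.
  by congr (E _ _); ring.
- by move=> x; have [L xL] := totE x; exists (L - w); rewrite subrK.
(* Grown from the single point [r], of length 0, the tree certifying the cost at 0 contains all
   terminals and competes with the star. *)
- move=> EL; have rT : r + 0 \in verts (point_tree r) by rewrite addr0 inE.
  have [T [tT rsubT qT]] := treeE _ _ _ EL (point_treeP r) rT.
  rewrite point_tree_length add0r -lerBlDr => lT; apply: le_trans lT.
  rewrite subr_ge0 wE; apply: min_star => // [|i]; last by rewrite qT ?inE.
  by apply: (fsubsetP rsubT); rewrite inE.
exists (- psi); apply: subE => x L xL; rewrite opp_lfunE.
have /psiE : E x (L - w + w) by rewrite subrK.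
lra.
Qed.

(** * Both directions, with the terminals other than the centre indexed by [q] *)

Theorem theorem15 (R : realType) (n : nat) (N : 'rV[R]_n -> R)
    (hN : is_norm N) (k : nat) (hk : (0 < k)%N)
    (p : 'I_k.+1 -> 'rV[R]_n) (hp : injective p) :
  is_SMT N [fset p i | i : 'I_k.+1]%fset
    (star (p ord0) [fset p (lift ord0 i) | i : 'I_k]%fset)
  <->
  (forall S : set (dual R n),
     parenthesization N (fun i : 'I_k => norming N (p (lift ord0 i) - p ord0))
       [set: 'I_k]%SET S ->
     S !=set0).
Proof.
pose q i := p (lift ord0 i); set L := [fset p (lift ord0 i) | i : 'I_k]%fset.
have q_inj : injective q by move=> i j /hp /lift_inj.
have qp0 i : q i != p ord0 by rewrite (inj_eq hp) eq_sym neq_lift.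
have p0L : p ord0 \notin L.
  by apply/negP => /imfsetP[i _ /esym/eqP]; apply/negP; exact: qp0.
have starE : graph_length N (star (p ord0) L) = \sum_i N (q i - p ord0).
  rewrite star_length // /L big_imfset /= => [|i j _ _]; last exact: q_inj.
  by rewrite big_enum.
split=> [[_ smt] S|parS].
  (* A tree through the centre and all [q i] is a Steiner tree of the whole set. *)
  apply: paren_nonempty => // T tT p0T qT; rewrite -starE; apply: smt.
  split=> //; apply/fsubsetP => _ /imfsetP[i _ ->].
  by case: (unliftP ord0 i) => [j|] ->; [exact: qT|].
split.
  split; first exact: star_tree.
  apply/fsubsetP => _ /imfsetP[i _ ->]; rewrite /= in_fset1U.
  case: (unliftP ord0 i) => [j|] ->; last by rewrite eqxx.
  by apply/orP; right; apply/imfsetP; exists j.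
move=> T [[gT cT _] PT]; rewrite starE.
(* [0 < k] provides an index, so the family is nonempty. *)
apply: (star_le_connected (Ordinal hk)) => // [|i];
  by apply: (fsubsetP PT); apply/imfsetP; eexists.
Qed.
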